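(* For each cell $C=F_wSG$ there exists a unique $(b_0,b_1,b_2)\in\mathbb{R}^3$ with $b_0+b_1+b_2=1$ such that $$\frac{1}{\nu(C)}\int_C\frac{d\nu_{f,g}}{d\nu}\,d\nu=\sum_{j=0}^2 b_j\,\frac{d\nu_{f,g}}{d\nu}\big(F_w(q_j)\big)$$ for all (not necessarily positive) energy measures $\nu_{f,g}$ of harmonic functions on $SG$. Explicitly, for $j=0,1,2$ (columns indexed by $0,1,2$), $$b_j=\frac16+\frac12\cdot\frac{\text{sum of the entries of column } j \text{ of } M_w}{\text{sum of all entries of } M_w}.$$
   Context: Let $q_0,q_1,q_2$ be the vertices of an equilateral triangle in $\mathbb{R}^2$, $F_i(x)=\frac12(x+q_i)$, and let $SG$ be the unique nonempty compact set with $SG=\bigcup_{i=0}^2F_i(SG)$. For a finite (possibly empty) word $w=(w_1,\dots,w_m)$ in $\{0,1,2\}$ put $|w|=m$, $F_w=F_{w_1}\circ\cdots\circ F_{w_m}$; the sets $F_wSG$ are cells. For continuous $u,v$ on $SG$ put $\mathcal{E}_m(u,v)=\left(\frac53\right)^m\sum_{|w|=m}\sum_{i<j}(u(F_wq_i)-u(F_wq_j))(v(F_wq_i)-v(F_wq_j))$, $\mathcal{E}(u,v)=\lim_m\mathcal{E}_m(u,v)$ (finite energy). A function $h$ is harmonic if $\mathcal{E}_m(h,h)$ is independent of $m$; harmonic functions are uniquely determined by arbitrary values at $q_0,q_1,q_2$, and $h_i$ is the harmonic function with $h_i(q_j)=\delta_{ij}$. For $f,g$ harmonic, $\nu_{f,g}$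 is the signed Borel measure on $SG$ with $\nu_{f,g}(F_wSG)=\left(\frac53\right)^{|w|}\mathcal{E}(f\circ F_w,g\circ F_w)$ for all $w$; $\nu_i=\nu_{h_i,h_i}$; $\nu=\nu_0+\nu_1+\nu_2$ (Kusuoka measure). The energy measures of harmonic functions form the three-dimensional space with basis $\nu_0,\nu_1,\nu_2$; the notation $\nu_{f,g}$ is used for any element of it. At a vertex $x=F_vq_j$ the derivative is $\frac{d\nu_{f,g}}{d\nu}(x)=\lim_{m\to\infty}\frac{\nu_{f,g}(F_vF_j^mSG)}{\nu(F_vF_j^mSG)}$, which exists and is independent of the representation of $x$. Let $$M_0=\tfrac1{15}\begin{pmatrix}9&0&0\\2&2&-1\\2&-1&2\end{pmatrix},\quad M_1=\tfrac1{15}\begin{pmatrix}2&2&-1\\0&9&0\\-1&2&2\end{pmatrix},\quad M_2=\tfrac1{15}\begin{pmatrix}2&-1&2\\-1&2&2\\0&0&9\end{pmatrix}$$ and $M_w=M_{w_1}M_{w_2}\cdots M_{w_m}$ (identity for the empty word). *)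

(* Defs.v *)
From HB Require Import structures.
From mathcomp Require Import all_boot all_order all_algebra.
From mathcomp Require Import all_classical all_reals all_analysis.

Set Implicit Arguments.
Unset Strict Implicit.
Unset Printing Implicit Defensive.

Import Order.TTheory GRing.Theory Num.Theory.
Import numFieldNormedType.Exports.

Local Open Scope classical_set_scope.
Local Open Scope ring_scope.

(* The topology of 'rV[R]_2 comes from the sup norm, which is equivalent to
   the Euclidean one; distances are only needed to say "equilateral". *)
Definition edist (R : realType) (x y : 'rV[R]_2) : R :=
  Num.sqrt (\sum_k (x ord0 k - y ord0 k) ^+ 2).

Definition equilateral (R : realType) (q : 'I_3 -> 'rV[R]_2) : Prop :=
  exists2 s : R, 0 < s & forall i j, i != j -> edist (q i) (q j) = s.

Definition similarity (R : realType) (q : 'I_3 -> 'rV[R]_2) (i : 'I_3)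
    (x : 'rV[R]_2) : 'rV[R]_2 :=
  2^-1 *: (x + q i).

(* F_w = F_{w_1} \o ... \o F_{w_m}: the first letter acts last. *)
Definition word_map (R : realType) (q : 'I_3 -> 'rV[R]_2) (w : seq 'I_3)
    (x : 'rV[R]_2) : 'rV[R]_2 :=
  foldr (similarity q) x w.

Definition is_sierpinski (R : realType) (q : 'I_3 -> 'rV[R]_2)
    (SG : set 'rV[R]_2) : Prop :=
  [/\ SG !=set0, compact SG & SG = \bigcup_(i in [set: 'I_3]) similarity q i @` SG].

Definition cell (R : realType) (q : 'I_3 -> 'rV[R]_2) (SG : set 'rV[R]_2)
    (w : seq 'I_3) : set 'rV[R]_2 :=
  word_map q w @` SG.

(* Functions on SG are represented by functions on the plane; only their
   values on SG are ever used. *)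
Definition energy_level (R : realType) (q : 'I_3 -> 'rV[R]_2) (m : nat)
    (u v : 'rV[R]_2 -> R) : R :=
  (5 / 3) ^+ m * \sum_(w : m.-tuple 'I_3) \sum_(i < 3) \sum_(j < 3 | (i < j)%N)
    (u (word_map q w (q i)) - u (word_map q w (q j))) *
    (v (word_map q w (q i)) - v (word_map q w (q j))).

Definition energy (R : realType) (q : 'I_3 -> 'rV[R]_2)
    (u v : 'rV[R]_2 -> R) : R :=
  limn (fun m => energy_level q m u v).

Definition harmonic (R : realType) (q : 'I_3 -> 'rV[R]_2)
    (SG : set 'rV[R]_2) (h : 'rV[R]_2 -> R) : Prop :=
  {within SG, continuous h} /\
  forall m n, energy_level q m h h = energy_level q n h h.

Definition harmonic_basis (R : realType) (q : 'I_3 -> 'rV[R]_2)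
    (SG : set 'rV[R]_2) (h : 'I_3 -> 'rV[R]_2 -> R) : Prop :=
  forall i, harmonic q SG (h i) /\ forall j, h i (q j) = (i == j)%:R.

Definition borel_plane (R : realType) :=
  g_sigma_algebraType (@open 'rV[R]_2).

(* A Borel measure on SG is a Borel measure on the plane which does not charge
   the complement of SG. *)
Definition is_energy_measure (R : realType) (q : 'I_3 -> 'rV[R]_2)
    (SG : set 'rV[R]_2) (f g : 'rV[R]_2 -> R)
    (mu : set (borel_plane R) -> \bar R) : Prop :=
  (forall A : set (borel_plane R), measurable A -> mu A = mu (A `&` SG)) /\
  forall w : seq 'I_3, mu (cell q SG w) =
    ((5 / 3) ^+ size w * energy q (f \o word_map q w) (g \o word_map q w))%:E.

(* The linear span of all nu_{f,g} with f, g harmonic, i.e. of nu_0, nu_1 and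
   nu_2; it also contains signed measures, such as the Kusuoka measure itself,
   that are not of the form nu_{f,g} for a single pair. *)
Definition in_energy_measure_space (R : realType) (q : 'I_3 -> 'rV[R]_2)
    (SG : set 'rV[R]_2) (mu : set (borel_plane R) -> \bar R) : Prop :=
  exists (n : nat) (c : 'I_n -> R) (f g : 'I_n -> 'rV[R]_2 -> R)
    (nufg : 'I_n -> {charge set (borel_plane R) -> \bar R}),
    (forall k, [/\ harmonic q SG (f k), harmonic q SG (g k)
                 & is_energy_measure q SG (f k) (g k) (nufg k)]) /\
    forall A : set (borel_plane R), measurable A ->
      mu A = (\sum_(k < n) (c k)%:E * nufg k A)%E.

Section kusuoka.
Variables (R : realType)
  (nu : 'I_3 -> {finite_measure set (borel_plane R) -> \bar R}).

Definition kusuoka : set (borel_plane R) -> \bar R :=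
  measure_add (measure_add (nu 0) (nu 1)) (nu 2).

HB.instance Definition _ := Measure.on kusuoka.

Let kusuoka_fin : fin_num_fun kusuoka.
Proof.
move=> A mA.
have -> : kusuoka A = (nu 0%R A + nu 1%R A + nu 2%R A)%E.
  rewrite [LHS]measure_addE; congr (_ + _)%E; exact: measure_addE.
by rewrite !fin_numD !(fin_num_measure (nu _)).
Qed.

HB.instance Definition _ := @Measure_isFinite.Build _ _ _ kusuoka kusuoka_fin.

End kusuoka.

(* d mu / d nu at the vertex F_v q_j, given by a representation (v, j) of that
   vertex; the value depends on the point F_v q_j only. *)
Definition vertex_derivative (R : realType) (q : 'I_3 -> 'rV[R]_2)
    (SG : set 'rV[R]_2) (mu nu : set (borel_plane R) -> \bar R)
    (v : seq 'I_3) (j : 'I_3) : R :=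
  limn (fun m => fine (mu (cell q SG (v ++ nseq m j))) /
                 fine (nu (cell q SG (v ++ nseq m j)))).

Definition cell_average (R : realType) (q : 'I_3 -> 'rV[R]_2)
    (SG : set 'rV[R]_2) (mu : {charge set (borel_plane R) -> \bar R})
    (nu : {finite_measure set (borel_plane R) -> \bar R}) (w : seq 'I_3) : R :=
  (fine (nu (cell q SG w)))^-1 *
  fine (\int[nu]_(x in cell q SG w) (Radon_Nikodym mu nu) x)%E.

Definition mx3 (R : realType) (s : seq (seq R)) : 'M[R]_3 :=
  \matrix_(i, j) nth 0 (nth [::] s i) j.

Definition Mgen (R : realType) (i : 'I_3) : 'M[R]_3 :=
  15^-1 *: nth 0
    [:: mx3 [:: [:: 9;  0;  0]; [:: 2;  2; -1]; [:: 2; -1; 2]];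
        mx3 [:: [:: 2;  2; -1]; [:: 0;  9;  0]; [:: -1; 2; 2]];
        mx3 [:: [:: 2; -1;  2]; [:: -1; 2;  2]; [:: 0;  0; 9]]] i.

Definition Mword (R : realType) (w : seq 'I_3) : 'M[R]_3 :=
  \prod_(i <- w) Mgen R i.

Definition cell_weights (R : realType) (q : 'I_3 -> 'rV[R]_2)
    (SG : set 'rV[R]_2) (nu : {finite_measure set (borel_plane R) -> \bar R})
    (w : seq 'I_3) (b : 'rV[R]_3) : Prop :=
  \sum_j b ord0 j = 1 /\
  forall mu : {charge set (borel_plane R) -> \bar R},
    in_energy_measure_space q SG mu ->
    cell_average q SG mu nu w =
    \sum_j b ord0 j * vertex_derivative q SG mu nu w j.

(* Main.v *)
Require Import Defs.
From mathcomp Require Import all_boot all_order all_algebra.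
From mathcomp Require Import all_classical all_reals all_analysis.
From mathcomp Require Import ring lra.
Import Order.TTheory GRing.Theory Num.Theory.
Import numFieldNormedType.Exports.
Local Open Scope classical_set_scope.
Local Open Scope ring_scope.

Set Implicit Arguments.
Unset Strict Implicit.
Unset Printing Implicit Defensive.

(** The energy measure of any pair of harmonic functions is determined on cells
    by a row vector [a] of three coordinates, those of the measure in the basis
    of the measures [nu i].  The one-fifth, two-fifths rule for harmonic
    functions says that zooming into the cell of a letter [j] multiplies [a] by
    [Mgen R j] ([polar_coord_similarity]); hence every measure [mu] of the space
    gives the cell of [w] the mass 2 times the sum of the entries of
    [a *m Mword R w] ([has_coord_space]), and the Kusuoka measure is the case
    where all three entries of [a] are 1.  That harmonic functions, defined by
    the constancy of their energies, do obey the rule is a convexity argument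
    ([harmonic_local]).

    Both sides of the quadrature formula then become explicit.  Let
    [t = a *m Mword R w], let [T] be the sum of its entries, let [s] be the row
    of column sums of [Mword R w] and [S] the sum of all its entries.
    The average over the cell is [T / S].  Descending to the vertex [j] means
    multiplying by powers of [Mgen R j], whose dominant right eigenvector is 1
    plus 3 times the [j]-th basis vector, so the derivative there is
    [(T + 3 t_j) / (S + 3 s_j)] ([vertex_derivative_coord]).  With
    [b_j = (S + 3 s_j) / (6 S)] the weighted sum collapses to
    [(3 T + 3 T) / (6 S) = T / S].  These weights are the only ones because
    [Mword R w] is invertible ([cell_weights_unique]).

    Two points need care.  The denominators must be positive: the row vectors
    of positive sum on which the second elementary symmetric polynomial is
    positive form a cone stable under the matrices ([mulMword_cone]).  And the
    average is an integral of a Radon-Nikodym derivative, so it equals a mass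
    quotient only if [mu] is absolutely continuous with respect to the Kusuoka
    measure.  This follows because a charge carried by the gasket that vanishes
    on all cells is zero ([charge_cells_eq0]): distinct cells of one level
    overlap in vertices only, vertices have no mass, and a closed set is the
    decreasing limit of the unions of the cells that meet it. *)

(** * The transition matrices on coordinates *)

(** Ordinals built from closed proofs, so that comparisons between them and
    list lookups at them compute. *)
Definition i0 : 'I_3 := @Ordinal 3 0 isT.
Definition i1 : 'I_3 := @Ordinal 3 1 isT.
Definition i2 : 'I_3 := @Ordinal 3 2 isT.

Lemma ord3_ind (P : 'I_3 -> Prop) : P i0 -> P i1 -> P i2 -> forall i, P i.
Proof.
move=> P0 P1 P2 [[|[|[|//]]] lti].
- by rewrite (_ : Ordinal lti = i0) //; exact: val_inj.
- by rewrite (_ : Ordinal lti = i1) //; exact: val_inj.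
- by rewrite (_ : Ordinal lti = i2) //; exact: val_inj.
Qed.

Lemma sum3E (V : nmodType) (F : 'I_3 -> V) : \sum_i F i = F i0 + F i1 + F i2.
Proof.
rewrite !big_ord_recl big_ord0 addr0 addrA.
by congr (F _ + F _ + F _); exact: val_inj.
Qed.

Section Algebra.
Variable R : realType.
Implicit Types (s : 'rV[R]_3) (w v : seq 'I_3) (i j k : 'I_3).

Definition row3 (a b c : R) : 'rV[R]_3 := \row_j [:: a; b; c]`_j.

Definition coord_sum s : R := \sum_j s 0 j.

Lemma coord_sumZ (c : R) s : coord_sum (c *: s) = c * coord_sum s.
Proof. by rewrite /coord_sum mulr_sumr; apply: eq_bigr => j _; rewrite mxE. Qed.

Lemma coord_sumD s t : coord_sum (s + t) = coord_sum s + coord_sum t.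
Proof. by rewrite /coord_sum -big_split; apply: eq_bigr => j _; rewrite mxE. Qed.

Lemma coord_sum0 : coord_sum (0 : 'rV[R]_3) = 0.
Proof. by rewrite /coord_sum big1 // => j _; rewrite mxE. Qed.

Lemma coord_sum_sum n (F : 'I_n -> 'rV[R]_3) :
  coord_sum (\sum_k F k) = \sum_k coord_sum (F k).
Proof. by apply: (big_morph _ coord_sumD coord_sum0). Qed.

Lemma coord_sum_mulmx (a : 'rV[R]_3) (M : 'M[R]_3) :
  coord_sum (a *m M) = \sum_i a 0 i * coord_sum (delta_mx 0 i *m M).
Proof.
rewrite {1}(row_sum_delta a) mulmx_suml coord_sum_sum.
by apply: eq_bigr => i _; rewrite -scalemxAl coord_sumZ.
Qed.

(** The coordinates are those of a symmetric tensor over the plane of harmonic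
    functions modulo constants, and up to a factor this is its determinant: it
    vanishes at the measures of single functions, which are the extreme rays of
    the cone of nonnegative measures. *)
Definition esym2 s : R := s 0 i0 * s 0 i1 + s 0 i1 * s 0 i2 + s 0 i2 * s 0 i0.

Definition mulMgen_row s j : 'rV[R]_3 :=
  row3 (15^-1 * [:: 9 * s 0 i0 + 2 * s 0 i1 + 2 * s 0 i2;
                    2 * s 0 i0 - s 0 i2;
                    2 * s 0 i0 - s 0 i1]`_j)
       (15^-1 * [:: 2 * s 0 i1 - s 0 i2;
                    2 * s 0 i0 + 9 * s 0 i1 + 2 * s 0 i2;
                    2 * s 0 i1 - s 0 i0]`_j)
       (15^-1 * [:: 2 * s 0 i2 - s 0 i1;
                    2 * s 0 i2 - s 0 i0;
                    2 * s 0 i0 + 2 * s 0 i1 + 9 * s 0 i2]`_j).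

Lemma mulMgenE s j : s *m Mgen R j = mulMgen_row s j.
Proof.
apply/rowP => k; rewrite !mxE sum3E.
elim/ord3_ind: j; elim/ord3_ind: k; rewrite /Mgen /mx3 !mxE /=; lra.
Qed.

(** The row sums of [Mgen R j] are 9/15 at [j] and 3/15 elsewhere. *)
Lemma mulMgen_coord_sum s j : coord_sum (s *m Mgen R j) = (3 * coord_sum s + 6 * s 0 j) / 15.
Proof.
rewrite mulMgenE /coord_sum !sum3E !mxE; elim/ord3_ind: j => /=; lra.
Qed.

(** Zooming into a cell maps measures of single functions to measures of single
    functions, so it preserves the cone cut out by [esym2] and can only rescale
    this quadratic form. *)
Lemma mulMgen_esym2 s j : esym2 (s *m Mgen R j) = esym2 s / 25.
Proof. rewrite mulMgenE /esym2 !mxE; by elim/ord3_ind: j => /=; field. Qed.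

(** In the cone a negative entry is dominated by the two others: if [a < 0] then
    [-a * (b + c) < b * c <= (b + c) ^+ 2 / 4], whence [b + c > -4 * a]. *)
Lemma coord_sum_add3_gt0 s j : 0 < coord_sum s -> 0 < esym2 s -> 0 < coord_sum s + 3 * s 0 j.
Proof.
rewrite /coord_sum /esym2 sum3E.
have H (a b c : R) : 0 < a + b + c -> 0 < a * b + b * c + c * a ->
    0 < a + b + c + 3 * a.
  move=> S_gt0 e_gt0; have [a_ge0|a_lt0] := leP 0 a; first by lra.
  have : 0 < (b + c) * (4 * a + b + c) by have := sqr_ge0 (b - c); nra.
  by rewrite pmulr_rgt0; lra.
move=> S_gt0 e_gt0; elim/ord3_ind: j.
- exact: H.
- by have := H (s 0 i1) (s 0 i2) (s 0 i0); lra.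
- by have := H (s 0 i2) (s 0 i0) (s 0 i1); lra.
Qed.

Lemma Mword_cons j w : Mword R (j :: w) = Mgen R j *m Mword R w.
Proof. by rewrite /Mword big_cons. Qed.

Lemma Mword_cat w v : Mword R (w ++ v) = Mword R w *m Mword R v.
Proof. by rewrite /Mword big_cat. Qed.

(** The cone is stable under every matrix product, because the new sum of
    entries is a positive combination of quantities positive on the cone. *)
Lemma mulMword_cone s w : 0 < coord_sum s -> 0 < esym2 s ->
  0 < coord_sum (s *m Mword R w) /\ 0 < esym2 (s *m Mword R w).
Proof.
elim: w s => [|j w IHw] s s_gt0 e_gt0; first by rewrite /Mword big_nil mulmx1.
rewrite Mword_cons mulmxA; apply: IHw.
  by rewrite mulMgen_coord_sum; have := coord_sum_add3_gt0 j s_gt0 e_gt0; lra.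
by rewrite mulMgen_esym2; lra.
Qed.

Lemma Mgen_unit j : Mgen R j \in unitmx.
Proof.
rewrite -row_free_unit -kermx_eq0; apply/eqP/row_matrixP => i.
have : row i (kermx (Mgen R j)) *m Mgen R j = 0 by rewrite -row_mul mulmx_ker row0.
move: (row i _) => s; rewrite row0 mulMgenE => s0; apply/rowP => k.
have := congr1 (fun t : 'rV_3 => (t 0 i0, t 0 i1, t 0 i2)) s0.
rewrite /mulMgen_row !mxE.
by elim/ord3_ind: j {s0}; elim/ord3_ind: k; move=> /= [? ? ?]; lra.
Qed.

Lemma Mword_unit w : Mword R w \in unitmx.
Proof.
elim: w => [|j w IHw]; first by rewrite /Mword big_nil unitmx1.
by rewrite Mword_cons unitmx_mul Mgen_unit IHw.
Qed.

(** The constant vector is the sum of two eigenvectors of [Mgen R j]: with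
    [e_j] the basis vector, [(1 + 3 e_j) / 4] has eigenvalue 3/5 and
    [3 (1 - e_j) / 4] has eigenvalue 1/15. *)
Lemma coord_sum_mul_nseq s m j : coord_sum (s *m Mword R (nseq m j)) =
  (3 / 5) ^+ m / 4 * (coord_sum s + 3 * s 0 j) +
  (15^-1) ^+ m * (3 / 4) * (coord_sum s - s 0 j).
Proof.
elim: m s => [|m IHm] s.
  by rewrite /Mword big_nil mulmx1 !expr0; lra.
rewrite /= Mword_cons mulmxA IHm mulMgen_coord_sum !exprS.
have -> : (s *m Mgen R j) 0 j = (2 * coord_sum s + 7 * s 0 j) / 15.
  by rewrite mulMgenE !mxE /coord_sum sum3E; elim/ord3_ind: j {IHm} => /=; lra.
by field.
Qed.

(** Along the constant word of letter [j] the eigenvalue 3/5 dominates, so the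
    quotient tends to that of the components along its eigenvector. *)
Lemma cvg_coord_sum_ratio s t j : coord_sum t + 3 * t 0 j != 0 ->
  (fun m => (2 * coord_sum (s *m Mword R (nseq m j))) /
            (2 * coord_sum (t *m Mword R (nseq m j)))) @ \oo -->
  (coord_sum s + 3 * s 0 j) / (coord_sum t + 3 * t 0 j).
Proof.
set B := coord_sum t + _ => B_neq0.
(* Once the powers of 3/5 are factored out, those of 1/15 become powers of 1/9. *)
pose num (u : 'rV[R]_3) m : R :=
  (coord_sum u + 3 * u 0 j) + 3 * (coord_sum u - u 0 j) * (9^-1) ^+ m.
have cvg_num u : num u @ \oo --> coord_sum u + 3 * u 0 j.
  rewrite -[X in _ --> X]addr0; apply: cvgD; first exact: cvg_cst.
  by apply: cvg_geometric; rewrite ger0_norm ?invr_ge0 // invf_lt1 // ltr1n.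
have numE u m : 2 * coord_sum (u *m Mword R (nseq m j)) = (3 / 5) ^+ m / 2 * num u m.
  rewrite coord_sum_mul_nseq /num.
  have -> : (15^-1) ^+ m = (3 / 5) ^+ m * 9^-1 ^+ m :> R.
    by rewrite -exprMn; congr (_ ^+ _); field.
  by field.
rewrite (_ : (fun _ => _) = (fun m => num s m / num t m)); last first.
  by apply/funext => m; rewrite !numE -mulf_div divff ?mul1r.
by apply: cvgM => //; exact: cvgV.
Qed.

End Algebra.

(** * Harmonic functions on the vertices *)

Section Harmonic.
Variables (R : realType) (q : 'I_3 -> 'rV[R]_2).
Implicit Types (u v f g : 'rV[R]_2 -> R) (w : seq 'I_3) (i j k : 'I_3).
Local Notation F := (similarity q).

Lemma word_map_cat w1 w2 : word_map q (w1 ++ w2) = word_map q w1 \o word_map q w2.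
Proof. by apply/funext => x; rewrite /word_map foldr_cat. Qed.

Lemma similarity_fixed i : F i (q i) = q i.
Proof.
by rewrite /similarity -{1 2}[q i]scale1r -scalerDl scalerA mulVf ?scale1r.
Qed.

Lemma similarity_vertexC i j : F i (q j) = F j (q i).
Proof. by rewrite /similarity addrC. Qed.

Definition edge_sum (x y : 'I_3 -> R) : R :=
  (x i0 - x i1) * (y i0 - y i1) + (x i0 - x i2) * (y i0 - y i2) +
  (x i1 - x i2) * (y i1 - y i2).

Lemma energy_level0 u v : energy_level q 0 u v = edge_sum (u \o q) (v \o q).
Proof.
rewrite /energy_level expr0 mul1r (big_pred1 [tuple]); last first.
  by move=> t; rewrite /= [t]tuple0; apply/esym/eqP.
under eq_bigr do rewrite big_mkcond sum3E.
by rewrite /edge_sum sum3E /=; ring.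
Qed.

Lemma energy_levelS m u v :
  energy_level q m.+1 u v = 5 / 3 * \sum_j energy_level q m (u \o F j) (v \o F j).
Proof.
rewrite /energy_level -mulr_sumr exprS -mulrA; congr (_ * (_ * _)).
rewrite [RHS]pair_big /=.
pose c (p : 'I_3 * m.-tuple 'I_3) := [tuple of p.1 :: p.2].
rewrite [LHS](reindex c) //=.
exists (fun t : m.+1.-tuple 'I_3 => (thead t, [tuple of behead t])).
  by move=> [j t] _; congr pair => //; exact: val_inj.
by move=> t _; apply/val_inj; rewrite /= [in RHS](tuple_eta t).
Qed.

(** The one-fifth, two-fifths rule: the two near vertices enter with weight 2/5
    and the far one with weight 1/5, here written through the sum of all three. *)
Definition midpoint_rule u : Prop := forall i j, i != j ->
  u (F i (q j)) = (u (q i) + u (q j) + \sum_k u (q k)) / 5.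

Definition locally_harmonic u : Prop := forall w, midpoint_rule (u \o word_map q w).

Lemma locally_harmonic_comp u w : locally_harmonic u ->
  locally_harmonic (u \o word_map q w).
Proof. by move=> hu v; rewrite -compA -word_map_cat; exact: hu. Qed.

Definition energy_gap u : R :=
  5 / 3 * \sum_j energy_level q 0 (u \o F j) (u \o F j) - energy_level q 0 u u.

Definition defect u i j : R :=
  u (F i (q j)) - (u (q i) + u (q j) + \sum_k u (q k)) / 5.

(** Subtracting its minimizer from the level-1 energy, a quadratic polynomial in
    the three midpoint values, leaves a positive definite form in the
    deviations from the midpoint rule. *)
Lemma energy_gapE u : let a := defect u i0 i1 in let b := defect u i1 i2 in
  let c := defect u i2 i0 in
  energy_gap u = 10 / 3 * (a ^+ 2 + b ^+ 2 + c ^+ 2) +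
    5 / 3 * ((a - b) ^+ 2 + (b - c) ^+ 2 + (c - a) ^+ 2).
Proof.
rewrite /= /energy_gap sum3E !energy_level0 /edge_sum /defect /= !similarity_fixed.
rewrite (similarity_vertexC i1 i0) (similarity_vertexC i2 i1) (similarity_vertexC i0 i2).
by rewrite !sum3E; field.
Qed.

Lemma energy_gap_ge0 u : 0 <= energy_gap u.
Proof.
rewrite energy_gapE; apply: addr_ge0; apply: mulr_ge0; rewrite ?divr_ge0 //;
  by rewrite !addr_ge0 ?sqr_ge0.
Qed.

Lemma energy_gap_eq0 u : energy_gap u = 0 -> midpoint_rule u.
Proof.
rewrite energy_gapE; set a := defect _ _ _; set b := defect _ _ _; set c := defect _ _ _.
have := (sqr_ge0 (a - b), sqr_ge0 (b - c), sqr_ge0 (c - a)) => -[[h1 h2] h3].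
have := (sqr_ge0 a, sqr_ge0 b, sqr_ge0 c) => -[[h4 h5] h6] gap0.
have a0 : a = 0 by apply/eqP; rewrite -sqrf_eq0; apply/eqP; lra.
have b0 : b = 0 by apply/eqP; rewrite -sqrf_eq0; apply/eqP; lra.
have c0 : c = 0 by apply/eqP; rewrite -sqrf_eq0; apply/eqP; lra.
move: a0 b0 c0; rewrite /a /b /c /defect.
rewrite (similarity_vertexC i2 i0) => a0 b0 c0.
move=> i j; elim/ord3_ind: i; elim/ord3_ind: j => // _;
 rewrite ?(similarity_vertexC i1 i0) ?(similarity_vertexC i2 i0) ?(similarity_vertexC i2 i1); lra.
Qed.

Lemma energy_level_mono m u : energy_level q m u u <= energy_level q m.+1 u u.
Proof.
elim: m u => [|m IHm] u.
  by rewrite energy_levelS -subr_ge0; exact: energy_gap_ge0.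
rewrite energy_levelS [leRHS]energy_levelS ler_pM2l //.
by apply: ler_sum => j _; exact: IHm.
Qed.

(** The energy of each cell is nondecreasing under refinement, so if the total
    does not increase then neither does the contribution of any cell. *)
Lemma energy_level_const_gap m u :
  energy_level q m u u = energy_level q m.+1 u u ->
  forall w, size w = m -> midpoint_rule (u \o word_map q w).
Proof.
elim: m u => [|m IHm] u.
  rewrite energy_levelS => eqE w /size0nil ->; apply: energy_gap_eq0.
  by rewrite /energy_gap; rewrite eqE subrr.
rewrite energy_levelS [RHS]energy_levelS => /mulfI eqE [//|j w] [sz_w].
rewrite (_ : u \o _ = (u \o F j) \o word_map q w) //; apply: IHm => //.
apply/esym/eqP; rewrite -subr_eq0; apply/eqP; move: j {w sz_w} (isT : true).
apply: psumr_eq0P => [j _|]; first by rewrite subr_ge0 energy_level_mono.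
by rewrite sumrB eqE ?subrr // mulf_neq0 ?invr_eq0.
Qed.

Lemma harmonic_local (SG : set _) u : Defs.harmonic q SG u -> locally_harmonic u.
Proof.
move=> [_ constE] w; exact: (@energy_level_const_gap (size w) u (constE _ _)).
Qed.

(** Coordinates of the energy measure of [u] and [v] in the basis [nu i].  For
    [u = v] the entry at [i] is the product of the differences of [u] from the
    vertex [i] to the two others: expand [u] in the harmonic basis and use that
    the basis functions sum to 1, so that, for instance, the measure of [h 0]
    and [h 1] is half of [nu 2 - nu 0 - nu 1]. The general case is the
    polarization. *)
Definition polar_coord u v : 'rV[R]_3 :=
  let x i := u (q i) in let y i := v (q i) in
  row3 (((x i0 - x i1) * (y i0 - y i2) + (y i0 - y i1) * (x i0 - x i2)) / 2)
       (((x i1 - x i0) * (y i1 - y i2) + (y i1 - y i0) * (x i1 - x i2)) / 2)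
       (((x i2 - x i0) * (y i2 - y i1) + (y i2 - y i0) * (x i2 - x i1)) / 2).

(** The linear recursion behind the whole proof: on bilinear expressions in
    the boundary values, harmonic extension to a subcell acts by [Mgen R j]. *)
Lemma polar_coord_similarity u v j : midpoint_rule u -> midpoint_rule v ->
  (5 / 3) *: polar_coord (u \o F j) (v \o F j) = polar_coord u v *m Mgen R j.
Proof.
move=> hu hv; rewrite mulMgenE.
apply/rowP => k; rewrite !mxE /=.
elim/ord3_ind: j; rewrite similarity_fixed !hu // !hv // !sum3E;
  by elim/ord3_ind: k => /=; field.
Qed.

Lemma polar_coord_word u v w : locally_harmonic u -> locally_harmonic v ->
  (5 / 3) ^+ size w *: polar_coord (u \o word_map q w) (v \o word_map q w) =
  polar_coord u v *m Mword R w.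
Proof.
elim: w u v => [|j w IHw] u v hu hv.
  by rewrite expr0 scale1r /Mword big_nil mulmx1.
rewrite Mword_cons mulmxA -polar_coord_similarity; [|exact: (hu [::])|exact: (hv [::])].
rewrite -scalemxAl -(IHw (u \o F j) (v \o F j)) ?scalerA ?exprS //.
  exact: (@locally_harmonic_comp u [:: j]).
exact: (@locally_harmonic_comp v [:: j]).
Qed.

Lemma energy_level0_polar u v : energy_level q 0 u v = 2 * coord_sum (polar_coord u v).
Proof. by rewrite energy_level0 /edge_sum /coord_sum sum3E !mxE /=; field. Qed.

(** The energies of a pair do not depend on the level, because the three
    matrices add up to one whose row sums are 1. *)
Lemma energy_level_locally_harmonic m u v : locally_harmonic u -> locally_harmonic v ->
  energy_level q m u v = 2 * coord_sum (polar_coord u v).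
Proof.
elim: m u v => [|m IHm] u v hu hv; first exact: energy_level0_polar.
rewrite energy_levelS.
transitivity (2 * \sum_j coord_sum (polar_coord u v *m Mgen R j)).
  rewrite !mulr_sumr; apply: eq_bigr => j _.
  rewrite -polar_coord_similarity; [|exact: (hu [::])|exact: (hv [::])].
  rewrite coord_sumZ [RHS]mulrCA IHm //.
    exact: (@locally_harmonic_comp u [:: j]).
  exact: (@locally_harmonic_comp v [:: j]).
congr (2 * _); under eq_bigr do rewrite mulMgen_coord_sum.
by rewrite /coord_sum !sum3E; field.
Qed.

Lemma energy_cell u v w : locally_harmonic u -> locally_harmonic v ->
  (5 / 3) ^+ size w * energy q (u \o word_map q w) (v \o word_map q w) =
  2 * coord_sum (polar_coord u v *m Mword R w).
Proof.
move=> hu hv; rewrite -polar_coord_word // coord_sumZ mulrCA; congr (_ * _).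
rewrite /energy (_ : (fun _ => _) =
  fun=> 2 * coord_sum (polar_coord (u \o word_map q w) (v \o word_map q w))); last first.
  by apply/funext => m; apply: energy_level_locally_harmonic; exact: locally_harmonic_comp.
by rewrite lim_cst.
Qed.

Lemma polar_coord_basis (SG : set _) h i : harmonic_basis q SG h ->
  polar_coord (h i) (h i) = delta_mx 0 i.
Proof.
move=> hh; have hE k : h i (q k) = (i == k)%:R by have [] := hh i.
apply/rowP => j; rewrite !mxE /= !hE.
by elim/ord3_ind: i {hE}; elim/ord3_ind: j => /=; rewrite ?eqxx; lra.
Qed.

End Harmonic.

(** * Geometry of the cells *)

Section Geometry.
Variables (R : realType) (q : 'I_3 -> 'rV[R]_2) (SG : set 'rV[R]_2).
Implicit Types (w : seq 'I_3) (i j k : 'I_3).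
Local Notation F := (similarity q).

(** Barycentric coordinates are used through these properties alone; the second
    one expresses that the similarity [j] is the midpoint map to [q j]. *)
Definition barycentric (lam : 'I_3 -> 'rV[R]_2 -> R) : Prop :=
  [/\ forall i, continuous (lam i),
      forall i j x, lam i (F j x) = (lam i x + (i == j)%:R) / 2,
      forall x, \sum_i lam i x = 1
    & forall x, x = \sum_i lam i x *: q i].

Definition cross (a b : 'rV[R]_2) : R := a 0 0 * b 0 1 - a 0 1 * b 0 0.

(** By the law of cosines two sides have scalar product [s ^+ 2 / 2]; Lagrange's
    identity then gives the square of the cross product. *)
Lemma equilateral_cross_neq0 : equilateral q -> cross (q i1 - q i0) (q i2 - q i0) != 0.
Proof.
move=> [s s_gt0 hs].
have sqE i j : i != j -> (q i 0 0 - q j 0 0) ^+ 2 + (q i 0 1 - q j 0 1) ^+ 2 = s ^+ 2.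
  move=> /hs <-; rewrite /edist sqr_sqrtr; last by apply: sumr_ge0 => k _; exact: sqr_ge0.
  rewrite !big_ord_recl big_ord0 addr0.
  by congr ((q i _ _ - q j _ _) ^+ 2 + (q i _ _ - q j _ _) ^+ 2); apply: val_inj.
have := (sqE i1 i0 isT, sqE i2 i0 isT, sqE i2 i1 isT) => -[[h10 h20] h21].
rewrite -sqrf_eq0 (_ : _ ^+ 2 = 3 / 4 * (s ^+ 2) ^+ 2); last first.
  rewrite /cross !mxE.
  move: h10 h20 h21; set a := q i0 0 0; set b := q i0 0 1; set c := q i1 0 0.
  set d := q i1 0 1; set e := q i2 0 0; set f := q i2 0 1 => h10 h20 h21.
  have dotE : (c - a) * (e - a) + (d - b) * (f - b) = s ^+ 2 / 2 by lra.
  transitivity (((c - a) ^+ 2 + (d - b) ^+ 2) * ((e - a) ^+ 2 + (f - b) ^+ 2) -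
    ((c - a) * (e - a) + (d - b) * (f - b)) ^+ 2); first by ring.
  by rewrite dotE h10 h20; field.
by rewrite mulf_neq0 ?expf_neq0 ?gt_eqF.
Qed.

Lemma rV2_eq (x y : 'rV[R]_2) : x 0 0 = y 0 0 -> x 0 1 = y 0 1 -> x = y.
Proof.
move=> h0 h1; apply/rowP => -[[|[|//]] lt2].
  by move: h0; congr (x _ _ = y _ _); apply: val_inj.
by move: h1; congr (x _ _ = y _ _); apply: val_inj.
Qed.

Lemma cross_cont (a b : 'rV[R]_2) : continuous (fun x : 'rV[R]_2 => cross (a - x) (b - x)).
Proof.
move=> x.
have sub_cont (c : 'rV[R]_2) (k : 'I_2) : {for x, continuous (fun y : 'rV[R]_2 => (c - y) 0 k)}.
  have cB : {for x, continuous (fun y : 'rV[R]_2 => c - y)}.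
    by apply: continuousB; [exact: cst_continuous|exact: cvg_id].
  exact: (continuous_comp cB (@coord_continuous _ _ _ 0 k (c - x))).
rewrite (_ : (fun y => _) = (fun y : 'rV[R]_2 => (a - y) 0 0 * (b - y) 0 1) \-
  (fun y : 'rV[R]_2 => (a - y) 0 1 * (b - y) 0 0)) //.
apply: continuousB.
  exact: (continuousM (sub_cont a 0) (sub_cont b 1)).
exact: (continuousM (sub_cont a 1) (sub_cont b 0)).
Qed.

Lemma barycentric_exists : equilateral q -> exists lam, barycentric lam.
Proof.
move=> /equilateral_cross_neq0; set D := cross _ _ => D_neq0.
exists (fun i x => [:: cross (q i1 - x) (q i2 - x); cross (q i2 - x) (q i0 - x);
  cross (q i0 - x) (q i1 - x)]`_i / D); split.
- move=> i x; elim/ord3_ind: i => /=;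
  exact: (continuousM (@cross_cont _ _ x) (@cst_continuous _ _ D^-1 x)).
- move=> i j x; move: D_neq0; rewrite /D /cross.
  by elim/ord3_ind: i; elim/ord3_ind: j; rewrite /= /similarity !mxE => ?; field.
- by move=> x; move: D_neq0; rewrite sum3E /D /cross /= !mxE => ?; field.
- move=> x; move: D_neq0; rewrite sum3E /D /cross !mxE /= => ?.
  by apply: rV2_eq; rewrite !mxE; field.
Qed.

Lemma similarity_cont i : continuous (F i).
Proof.
move=> x; have cD : {for x, continuous (fun y : 'rV[R]_2 => y + q i)}.
  by apply: continuousD; [exact: cvg_id|exact: cst_continuous].
exact: (continuous_comp cD (@scaler_continuous _ _ 2^-1 _)).
Qed.

Lemma word_map_cont w : continuous (word_map q w).
Proof.
elim: w => [|j w IHw] x; first exact: cvg_id.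
by apply: (continuous_comp (IHw x)); exact: similarity_cont.
Qed.

Lemma similarity_dist i x y : `|F i x - F i y| = 2^-1 * `|x - y|.
Proof.
by rewrite /similarity -scalerBr opprD addrACA subrr addr0 normrZ ger0_norm ?invr_ge0.
Qed.

Lemma word_map_dist w x y : `|word_map q w x - word_map q w y| = 2^-1 ^+ size w * `|x - y|.
Proof.
elim: w => [|j w IHw] /=; first by rewrite expr0 mul1r.
by rewrite similarity_dist IHw exprS mulrA.
Qed.

Lemma word_map_inj w : injective (word_map q w).
Proof.
move=> x y xy; apply/eqP; rewrite -subr_eq0 -normr_eq0.
have /eqP := word_map_dist w x y; rewrite xy subrr normr0 eq_sym mulf_eq0.
by rewrite expf_eq0 invr_eq0 pnatr_eq0 andbF.
Qed.

Hypotheses (hq : equilateral q) (hSG : is_sierpinski q SG).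

Lemma SG_similarity i x : SG x -> SG (F i x).
Proof. by case: hSG => _ _ {2}-> SGx; exists i => //; exists x. Qed.

Lemma SG_split x : SG x -> exists i, exists2 y, SG y & F i y = x.
Proof. by case: hSG => _ _ {1}-> [i _ [y SGy <-]]; exists i, y. Qed.

(** A barycentric coordinate is halved by the similarities up to a nonnegative
    shift, so its minimum over the gasket cannot be negative. *)
Lemma barycentric_ge0 lam i x : barycentric lam -> SG x -> 0 <= lam i x.
Proof.
move=> [lam_cont lamF _ _] SGx.
have [SG0 SGc _] := hSG.
have [c SGc' cmin] := compact_EVT_min SG0 SGc (continuous_subspaceT (lam_cont i)).
apply: le_trans (cmin x _); last exact/mem_set.
have /set_mem/SG_split[j [y SGy ycE]] := SGc'.
have := cmin y (mem_set SGy); rewrite -ycE lamF.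
by have : 0 <= (i == j)%:R :> R by []; lra.
Qed.

(** The other two coordinates are nonnegative with nonpositive sum. *)
Lemma barycentric_eq lam i x : barycentric lam -> SG x -> 1 <= lam i x -> x = q i.
Proof.
move=> hlam SGx lam1; have [_ _ sum1 xE] := hlam.
rewrite [LHS]xE.
have ge0 j := barycentric_ge0 j hlam SGx.
have := (sum1 x, ge0 i0, ge0 i1, ge0 i2).
rewrite !sum3E => -[[[S0 g0] g1] g2].
suff lamE j : lam j x = (j == i)%:R.
  by rewrite !lamE; elim/ord3_ind: i {lam1 lamE}; rewrite !scale0r scale1r ?addr0 ?add0r.
by elim/ord3_ind: i lam1; elim/ord3_ind: j => /=; rewrite ?eqxx; lra.
Qed.

(** The maximum [M] of the coordinate [j] on the gasket is reached; moving the
    maximal point towards [q j] gives [(M + 1) / 2 <= M], so [M] is at least 1. *)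
Lemma vertex_SG j : SG (q j).
Proof.
have [lam hlam] := barycentric_exists hq; have [lam_cont lamF _ _] := hlam.
have [SG0 SGc _] := hSG.
have [c SGc' cmax] := compact_EVT_max SG0 SGc (continuous_subspaceT (lam_cont j)).
move/set_mem in SGc'; rewrite -(barycentric_eq hlam SGc' (i := j)) //.
by have := cmax _ (mem_set (SG_similarity j SGc')); rewrite lamF eqxx /=; lra.
Qed.

(** A common point of two first-level cells has both coordinates at least 1/2,
    which forces it to be the midpoint of an edge, that is, the image of a vertex. *)
Lemma similarity_overlap i j x y : i != j -> SG x -> SG y -> F i x = F j y -> x = q j.
Proof.
move=> ij SGx SGy xy; have [lam hlam] := barycentric_exists hq.
have [_ lamF _ _] := hlam.
apply: (barycentric_eq hlam) => //.
have := lamF j i x; rewrite xy lamF eqxx eq_sym (negbTE ij) /=.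
by have := barycentric_ge0 j hlam SGy; lra.
Qed.

Lemma SG_word_map w x : SG x -> SG (word_map q w x).
Proof. by elim: w => //= j w IHw SGx; exact/SG_similarity/IHw. Qed.

Lemma sub_cell_cat w v : cell q SG (w ++ v) `<=` cell q SG w.
Proof.
move=> _ [x SGx <-]; rewrite word_map_cat; exists (word_map q v x) => //.
exact: SG_word_map.
Qed.

Lemma cell_cover m x : SG x -> exists2 w, size w = m & cell q SG w x.
Proof.
elim: m x => [|m IHm] x SGx; first by exists [::] => //; exists x.
have [j [y /IHm [w sz_w [z SGz <-]] <-]] := SG_split SGx.
by exists (j :: w); [rewrite /= sz_w|exists z].
Qed.

(** After the common prefix the words enter different first-level cells, which
    share a single vertex. *)
Lemma cell_overlap w w' : size w = size w' -> w != w' ->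
  exists v j, cell q SG w `&` cell q SG w' `<=` [set word_map q v (q j)].
Proof.
elim: w w' => [|i w IHw] [|j w'] //= [sz_ww'].
have [<-{j}|ij] := eqVneq i j.
  rewrite eqseq_cons eqxx /= => /(IHw _ sz_ww') [v [j sub]].
  exists (i :: v), j => _ [[x SGx <-] [y SGy /= /(@word_map_inj [:: i]) xy]] /=.
  by congr (F i _); apply: sub; split; [exists x|exists y].
move=> _; exists [:: i], j => _ [[x SGx <-] [y SGy /= xy]] /=.
congr (F i _); apply: (similarity_overlap ij (y := word_map q w' y)) => //;
  exact: SG_word_map.
Qed.

Lemma cell_compact w : compact (cell q SG w).
Proof.
apply: continuous_compact; last by case: hSG.
by apply: continuous_subspaceT; exact: word_map_cont.
Qed.

Lemma cell_closed w : closed (cell q SG w).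
Proof. by apply: compact_closed; [exact: norm_hausdorff|exact: cell_compact]. Qed.

Lemma cell_diam : exists2 D : R, 0 < D & forall w x y,
  cell q SG w x -> cell q SG w y -> `|x - y| <= D / 2 ^+ size w.
Proof.
have [_ /compact_bounded[M [Mreal hM]] _] := hSG.
pose M' := `|M| + 1.
have SGM x : SG x -> `|x| <= M'.
  by apply: hM; rewrite /M' (le_lt_trans (ler_norm M)) // ltrDl.
exists (M' + M'); first by rewrite addr_gt0 // /M' ltr_wpDl.
move=> w _ _ [x SGx <-] [y SGy <-]; rewrite word_map_dist mulrC exprVn.
by rewrite ler_wpM2r ?invr_ge0 ?exprn_ge0 // (le_trans (ler_normB _ _)) // lerD ?SGM.
Qed.

End Geometry.

(** * Charges are determined by the masses of cells *)

Section AlmostDisjoint.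
Local Open Scope ereal_scope.
Context d (T : measurableType d) (R : realType).
Variable mu : {finite_measure set T -> \bar R}.

Lemma measure_bigsetU_overlap0 (I : finType) (P : pred I) (A : I -> set T) :
    (forall i, measurable (A i)) ->
    (forall i j, i != j -> mu (A i `&` A j) = 0) ->
  mu (\big[setU/set0]_(i | P i) A i) = \sum_(i | P i) mu (A i).
Proof.
move=> mA A0; rewrite -big_filter -[RHS]big_filter.
have : uniq [seq i <- index_enum I | P i] by rewrite filter_uniq ?index_enum_uniq.
elim: [seq i <- _ | P i] => [|i s IHs]; first by rewrite !big_nil measure0.
rewrite cons_uniq => /andP[i_s uniq_s].
have mU : measurable (\big[setU/set0]_(j <- s) A j) by exact: bigsetU_measurable.
have fin_i : mu (A i) < +oo by rewrite ltey_eq fin_num_measure.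
rewrite !big_cons -IHs // (measureUfinl (mA i) mU fin_i).
suff I0 : mu (A i `&` \big[setU/set0]_(j <- s) A j) = 0.
  by rewrite -[RHS]sube0; congr (_ - _).
elim: s i_s {IHs uniq_s mU} => [_|j s IHs]; first by rewrite big_nil setI0 measure0.
rewrite inE negb_or big_cons setIUr => /andP[ij i_s].
apply: null_set_setU; [| |exact: A0|exact: IHs]; apply: measurableI => //.
exact: bigsetU_measurable.
Qed.

End AlmostDisjoint.

Section Gasket.
Variables (R : realType) (q : 'I_3 -> 'rV[R]_2) (SG : set 'rV[R]_2).
Hypotheses (hq : equilateral q) (hSG : is_sierpinski q SG).
Implicit Types (w : seq 'I_3) (i j k : 'I_3).
Local Notation T := (borel_plane R).

Lemma closed_measurable_plane (K : set 'rV[R]_2) :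
  closed K -> measurable (K : set T).
Proof.
move=> clK; rewrite -(setCK K); apply: measurableC; apply: sub_sigma_algebra.
exact: closed_openC.
Qed.

Lemma measurable_set1_plane (x : 'rV[R]_2) : measurable ([set x] : set T).
Proof.
apply: closed_measurable_plane.
by apply: compact_closed; [exact: norm_hausdorff|exact: compact_set1].
Qed.

Lemma cell_measurable w : measurable (cell q SG w : set T).
Proof. by apply: closed_measurable_plane; exact: cell_closed. Qed.

Lemma gasket_measurable : measurable (SG : set T).
Proof.
by apply: closed_measurable_plane; apply: compact_closed; [exact: norm_hausdorff|case: hSG].
Qed.

(** For closed [K] these sets decrease to the part of [K] in the gasket, and
    their mass is a sum of masses of cells: they reduce closed sets to cells. *)
Definition cell_neighborhood (K : set 'rV[R]_2) m : set T :=
  \big[setU/set0]_(t : m.-tuple 'I_3 | `[< cell q SG t `&` K !=set0 >]) cell q SG t.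

Lemma cell_neighborhoodP K m x : cell_neighborhood K m x <->
  exists w, [/\ size w = m, cell q SG w `&` K !=set0 & cell q SG w x].
Proof.
rewrite /cell_neighborhood -bigcup_seq_cond; split.
  by move=> [t /= /andP[_ /asboolP tK] tx]; exists t; rewrite size_tuple.
move=> [w [/eqP sz_w wK wx]]; exists (Tuple sz_w) => //=.
by rewrite mem_index_enum; exact/asboolP.
Qed.

Lemma cell_neighborhood_measurable K m : measurable (cell_neighborhood K m).
Proof. by apply: bigsetU_measurable => t _; exact: cell_measurable. Qed.

Lemma cell_neighborhood_decr K : nonincreasing_seq (cell_neighborhood K).
Proof.
apply/nonincreasing_seqP => m; apply/subsetPset => x.
move=> /cell_neighborhoodP[w [sz_w [y [wy Ky]] wx]]; apply/cell_neighborhoodP.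
exists (take m w); split; first by rewrite size_take sz_w ltnSn.
  by exists y; split => //; move: wy; rewrite -{1}(cat_take_drop m w); exact: sub_cell_cat.
by move: wx; rewrite -{1}(cat_take_drop m w); exact: sub_cell_cat.
Qed.

(** For every [m], a point of all these sets is no farther from [K] than the
    diameter of a cell of level [m]. *)
Lemma bigcap_cell_neighborhood K : closed K ->
  \bigcap_m cell_neighborhood K m = K `&` SG.
Proof.
move=> clK; apply/seteqP; split => x; last first.
  move=> [Kx SGx] m _; apply/cell_neighborhoodP.
  by have [w sz_w wx] := cell_cover hSG m SGx; exists w; split => //; exists x.
move=> capx; split; last first.
  have /cell_neighborhoodP[w [_ _]] := capx 0%N I.
  by move=> [y SGy <-]; exact: SG_word_map.
have [D D_gt0 hD] := cell_diam hSG.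
apply: clK => B /nbhs_ballP[e /= e_gt0 eB].
have [m Dme] : exists m, D / 2 ^+ m < e.
  exists (Num.bound (D / e)); rewrite ltr_pdivrMr ?exprn_gt0 // -ltr_pdivrMl // mulrC.
  exact: upper_nthrootP.
have /cell_neighborhoodP[w [sz_w [y [wy Ky]] wx]] := capx m I.
exists y; split => //; apply: eB; rewrite -ball_normE /=.
by apply: le_lt_trans (hD w _ _ wx wy) _; rewrite sz_w.
Qed.

Lemma bigcap_vertex_cell w j :
  \bigcap_m cell q SG (w ++ nseq m j) = [set word_map q w (q j)].
Proof.
have qjE m : word_map q (nseq m j) (q j) = q j.
  by elim: m => //= m ->; rewrite similarity_fixed.
have vert m : cell q SG (w ++ nseq m j) (word_map q w (q j)).
  by exists (q j); [exact: (vertex_SG hq hSG)|rewrite word_map_cat /= qjE].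
apply/seteqP; split => x; last by move=> -> m _.
move=> capx; have [D D_gt0 hD] := cell_diam hSG.
apply/eqP; rewrite -subr_eq0 -normr_le0; apply/ler_addgt0Pr => e e_gt0.
have Dle m : D / 2 ^+ (size w + m) <= D / 2 ^+ m.
  rewrite ler_wpM2l ?(ltW D_gt0) // lef_pV2 ?posrE ?exprn_gt0 // ler_weXn2l ?leq_addl //.
  by rewrite ler1n.
have := hD _ _ _ (capx (Num.bound (D / e)) I) (vert _).
rewrite size_cat size_nseq add0r => /le_trans; apply; apply: (le_trans (Dle _)).
rewrite ler_pdivrMr ?exprn_gt0 // -ler_pdivrMl // mulrC ltW //.
exact: upper_nthrootP.
Qed.

Variables m1 m2 : {finite_measure set T -> \bar R}.
Hypothesis eq_cell : forall w, m1 (cell q SG w) = m2 (cell q SG w).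

(** A vertex is the intersection of the cells that shrink to it. *)
Lemma eq_measure_vertex w j :
  m1 [set word_map q w (q j)] = m2 [set word_map q w (q j)].
Proof.
have cvg_cell (m : {finite_measure set T -> \bar R}) :
    (fun n => m (cell q SG (w ++ nseq n j))) @ \oo --> m [set word_map q w (q j)].
  rewrite -bigcap_vertex_cell; apply: nonincreasing_cvg_mu.
  - by rewrite ltey_eq fin_num_measure //; exact: cell_measurable.
  - by move=> n; exact: cell_measurable.
  - by rewrite bigcap_vertex_cell; exact: measurable_set1_plane.
  - apply/nonincreasing_seqP => n; apply/subsetPset.
    by rewrite -[n.+1]addn1 nseqD catA; exact: sub_cell_cat.
have := cvg_cell m1; under eq_fun do rewrite eq_cell.
by move=> /cvg_lim <- //; rewrite (cvg_lim _ (cvg_cell m2)).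
Qed.

Hypothesis vertex0 : forall w j, m1 [set word_map q w (q j)] = 0%E.
Hypothesis conc1 : forall A : set T, measurable A -> m1 A = m1 (A `&` SG).
Hypothesis conc2 : forall A : set T, measurable A -> m2 A = m2 (A `&` SG).

(** Cells of one level overlap in vertices, hence in null sets. *)
Lemma measure_cell_neighborhood (m : {finite_measure set T -> \bar R}) K n :
  (forall w j, m [set word_map q w (q j)] = 0%E) ->
  m (cell_neighborhood K n) =
  (\sum_(t : n.-tuple 'I_3 | `[< cell q SG t `&` K !=set0 >]) m (cell q SG t))%E.
Proof.
move=> m0; apply: measure_bigsetU_overlap0 => [t|t t' tt'].
  exact: cell_measurable.
have [|v [j sub]] := cell_overlap hq hSG (w := t) (w' := t') _ tt'.
  by rewrite !size_tuple.
have mI : measurable (cell q SG t `&` cell q SG t' : set T).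
  by apply: measurableI; exact: cell_measurable.
have mpt : measurable ([set word_map q v (q j)] : set T) by exact: measurable_set1_plane.
exact: (subset_measure0 mI mpt sub (m0 _ _)).
Qed.

Lemma eq_measure_closed (K : set 'rV[R]_2) : closed K -> m1 K = m2 K.
Proof.
move=> clK; have mK := closed_measurable_plane clK.
have cvg_nbh (m : {finite_measure set T -> \bar R}) :
    (fun n => m (cell_neighborhood K n)) @ \oo --> m (K `&` SG).
  rewrite -bigcap_cell_neighborhood //; apply: nonincreasing_cvg_mu.
  - by rewrite ltey_eq fin_num_measure //; exact: cell_neighborhood_measurable.
  - by move=> n; exact: cell_neighborhood_measurable.
  - by apply: bigcapT_measurable => n; exact: cell_neighborhood_measurable.
  - exact: cell_neighborhood_decr.
rewrite conc1 // conc2 // -(cvg_lim _ (cvg_nbh m1)) // -(cvg_lim _ (cvg_nbh m2)) //.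
congr (lim (_ @ \oo)); apply/funext => n.
rewrite !measure_cell_neighborhood //; first exact: eq_bigr.
by move=> w j; rewrite -eq_measure_vertex.
Qed.

(** Complements of closed sets are open, and open sets form a pi-system that
    generates the Borel sets. *)
Lemma eq_measure_cells (A : set T) : measurable A -> m1 A = m2 A.
Proof.
apply: (@measure_unique _ R T (@open 'rV[R]_2) (fun=> setT)) => //.
- exact: openI.
- by move=> _; exact: openT.
- by rewrite bigcup_const //; exists 0%N.
- move=> O oO; rewrite -(setCK O).
  have clO : closed (~` O) by exact: open_closedC.
  have mO := closed_measurable_plane clO.
  have mT : m1 setT = m2 setT by apply: eq_measure_closed; exact: closedT.
  have mO' : measurable (O : set T) by rewrite -(setCK O); exact: measurableC.
  have measureCE (m : {finite_measure set T -> \bar R}) :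
      m (~` ~` O) = (m setT - m (~` O))%E.
    rewrite -(setUv (~` O)) measureU ?setICr //; last by rewrite setCK.
    by rewrite [X in (X - _)%E]addeC addeK // fin_num_measure.
  apply: etrans (measureCE m1) (etrans _ (esym (measureCE m2))).
  by rewrite mT eq_measure_closed.
- by move=> _; rewrite ltey_eq fin_num_measure.
Qed.

End Gasket.

Section GasketCharge.
Local Open Scope ereal_scope.
Variables (R : realType) (q : 'I_3 -> 'rV[R]_2) (SG : set 'rV[R]_2).
Hypotheses (hq : equilateral q) (hSG : is_sierpinski q SG).
Variable sigma : {charge set (borel_plane R) -> \bar R}.

(** The two parts of the Jordan decomposition are finite measures that agree on
    cells.  To see that neither of them charges a vertex, note that agreement on
    cells makes [sigma] vanish at the vertex, while the positive part of a point
    is its [sigma]-mass or 0 according to the side of the Hahn decomposition. *)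
Lemma charge_cells_eq0 :
  (forall A : set (borel_plane R), measurable A -> sigma A = sigma (A `&` SG)) ->
  (forall w, sigma (cell q SG w) = 0) ->
  forall A : set (borel_plane R), measurable A -> sigma A = 0.
Proof.
move=> conc cell0 A mA; have [P [N PN]] := Hahn_decomposition sigma.
have [[mP _] [mN _] _ _] := PN.
have mSG : measurable (SG : set (borel_plane R)).
  exact: gasket_measurable hSG.
have sigmaE B : measurable B -> sigma B = jordan_pos PN B - jordan_neg PN B.
  by move=> mB; rewrite [LHS](jordan_decomp PN mB) /cadd /= cscaleN1.
have eqPN B : measurable B -> sigma B = 0 -> jordan_pos PN B = jordan_neg PN B.
  move=> mB s0; have fin_neg : jordan_neg PN B \is a fin_num by exact: fin_num_measure.
  by rewrite -[LHS](subeK _ fin_neg) -sigmaE // s0 add0e.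
have posE B : measurable B -> jordan_pos PN B = sigma (B `&` P).
  by move=> mB; rewrite jordan_posE cjordan_posE /crestr0 mem_set.
have negE B : measurable B -> jordan_neg PN B = - sigma (B `&` N).
  by move=> mB; rewrite jordan_negE cjordan_negE /crestr0 mem_set.
have eq_cells w : jordan_pos PN (cell q SG w) = jordan_neg PN (cell q SG w).
  by apply: eqPN => //; exact: cell_measurable.
have point0 w j : sigma [set word_map q w (q j)] = 0.
  rewrite sigmaE; last exact: measurable_set1_plane.
  rewrite [jordan_pos PN _](eq_measure_vertex hq hSG eq_cells).
  by apply: subee; apply: fin_num_measure; exact: measurable_set1_plane.
rewrite sigmaE // [jordan_pos PN _](eq_measure_cells hq hSG eq_cells) //.
- by apply: subee; exact: fin_num_measure.
- move=> w j; apply: etrans (posE _ (measurable_set1_plane _)) _.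
  by rewrite set1I; case: ifP => _ //; rewrite charge0.
- move=> B mB; have mBSG := measurableI _ _ mB mSG.
  apply: etrans (posE _ mB) (etrans _ (esym (posE _ mBSG))).
  by rewrite (conc _ (measurableI _ _ mB mP)) setIAC.
- move=> B mB; have mBSG := measurableI _ _ mB mSG.
  apply: etrans (negE _ mB) (etrans _ (esym (negE _ mBSG))).
  by rewrite (conc _ (measurableI _ _ mB mN)) setIAC.
Qed.

End GasketCharge.

(** * Averages and vertex derivatives *)

Section Charges.
Variables (R : realType) (q : 'I_3 -> 'rV[R]_2) (SG : set 'rV[R]_2).
Hypotheses (hq : equilateral q) (hSG : is_sierpinski q SG).
Variables (h : 'I_3 -> 'rV[R]_2 -> R) (nu : 'I_3 -> {finite_measure set (borel_plane R) -> \bar R}).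
Hypothesis (hh : harmonic_basis q SG h).
Hypothesis (hnu : forall i, is_energy_measure q SG (h i) (h i) (nu i)).
Local Notation T := (borel_plane R).
Implicit Types (w : seq 'I_3) (i j k : 'I_3) (a : 'rV[R]_3).

(** The factor 2 is the mass of each [nu i] on the whole gasket. *)
Definition has_coord (mu : set T -> \bar R) a : Prop :=
  forall w, mu (cell q SG w) = (2 * coord_sum (a *m Mword R w))%:E.

Lemma has_coord_energy_measure f g mu : is_energy_measure q SG f g mu ->
  Defs.harmonic q SG f -> Defs.harmonic q SG g -> has_coord mu (polar_coord q f g).
Proof.
by move=> [_ muE] hf hg w; rewrite muE (energy_cell w (harmonic_local hf) (harmonic_local hg)).
Qed.

Lemma has_coord_nu i : has_coord (nu i) (delta_mx 0 i).
Proof.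
rewrite -(polar_coord_basis i hh).
by apply: (has_coord_energy_measure (hnu i)); case: (hh i).
Qed.

Lemma has_coord_space mu : in_energy_measure_space q SG mu ->
  exists a, has_coord mu a.
Proof.
move=> [n [c [f [g [nufg [hfg muE]]]]]].
exists (\sum_k c k *: polar_coord q (f k) (g k)) => w.
rewrite muE; last exact: cell_measurable.
rewrite mulmx_suml coord_sum_sum mulr_sumr -sumEFin; apply: eq_bigr => k _.
have [hf hg hk] := hfg k.
by rewrite (has_coord_energy_measure hk hf hg) -scalemxAl coord_sumZ mulrCA.
Qed.

Lemma space_restrict mu (A : set T) : in_energy_measure_space q SG mu ->
  measurable A -> mu A = mu (A `&` SG).
Proof.
move=> [n [c [f [g [nufg [hfg muE]]]]]] mA.
have mSG : measurable (SG : set T) by exact: gasket_measurable hSG.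
rewrite !muE //; last exact: measurableI.
by apply: eq_bigr => k _; have [_ _ [-> ]] := hfg k.
Qed.

Lemma kusuokaE (A : set T) : kusuoka nu A = (nu i0 A + nu i1 A + nu i2 A)%E.
Proof.
have -> : kusuoka nu A = (nu 0%R A + nu 1%R A + nu 2%R A)%E.
  by rewrite [LHS]measure_addE; congr (_ + _)%E; exact: measure_addE.
by congr (nu _ A + nu _ A + nu _ A)%E; exact: val_inj.
Qed.

Lemma has_coord_kusuoka : has_coord (kusuoka nu) (const_mx 1).
Proof.
move=> w; rewrite kusuokaE !has_coord_nu -!EFinD -!mulrDr -!coord_sumD -!mulmxDl.
congr ((2 * coord_sum (_ *m _))%:E); apply/rowP => j; rewrite !mxE eqxx /=.
by elim/ord3_ind: j; rewrite /= ?addr0 ?add0r.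
Qed.

(** A measure of the space and the combination of the [nu i] with the same
    coordinates agree on cells, hence everywhere; so it vanishes wherever all
    the [nu i] do. *)
Lemma kusuoka_dominates (mu : {charge set T -> \bar R}) :
  in_energy_measure_space q SG mu -> mu `<< kusuoka nu.
Proof.
move=> hmu; have [a aE] := has_coord_space hmu.
pose part i : {charge set T -> \bar R} := cscale (- a 0 i) (charge_of_finite_measure (nu i)).
pose sigma : {charge set T -> \bar R} :=
  cadd (cadd (cadd mu (part i0)) (part i1)) (part i2).
have sigmaE (A : set T) : (sigma A = mu A + (- a 0 i0)%:E * nu i0 A +
  (- a 0 i1)%:E * nu i1 A + (- a 0 i2)%:E * nu i2 A)%E by [].
have sigma0 (A : set T) : measurable A -> sigma A = 0%E.
  apply: (charge_cells_eq0 hq hSG) => [B mB|w].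
    rewrite !sigmaE (space_restrict hmu mB).
    by have [-> // _] := hnu i0; have [-> // _] := hnu i1; have [-> // _] := hnu i2.
  rewrite sigmaE aE !has_coord_nu -!EFinM -!EFinD; congr (_%:E).
  by rewrite coord_sum_mulmx sum3E; ring.
apply/null_content_dominatesP => A mA nuA0.
have := kusuokaE A; rewrite [kusuoka nu A]nuA0 => /esym/eqP.
rewrite !padde_eq0 ?adde_ge0 // => /andP[/andP[/eqP n0 /eqP n1] /eqP n2].
by have := sigma0 A mA; rewrite sigmaE n0 n1 n2 !mule0 !adde0.
Qed.

Local Notation S w := (coord_sum ((const_mx 1 : 'rV[R]_3) *m Mword R w)).
Local Notation s w j := (((const_mx 1 : 'rV[R]_3) *m Mword R w) 0 j).

(** The coordinates [(1, 1, 1)] of the Kusuoka measure lie in the stable cone. *)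
Lemma col_sum_gt0 w : 0 < S w /\ forall j, 0 < S w + 3 * s w j.
Proof.
have [||S_gt0 e_gt0] := @mulMword_cone R (const_mx 1) w.
- by rewrite /coord_sum sum3E !mxE; lra.
- by rewrite /esym2 !mxE; lra.
by split => // j; exact: coord_sum_add3_gt0.
Qed.

Lemma cell_average_coord (mu : {charge set T -> \bar R}) a w :
  in_energy_measure_space q SG mu -> has_coord mu a ->
  cell_average q SG mu (kusuoka nu) w = coord_sum (a *m Mword R w) / S w.
Proof.
move=> hmu aE; rewrite /cell_average -Radon_Nikodym_integral; last 2 first.
- exact: kusuoka_dominates.
- exact: cell_measurable.
rewrite aE [X in (fine X)^-1](has_coord_kusuoka w) /=; have [S_gt0 _] := col_sum_gt0 w.
by field; rewrite gt_eqF.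
Qed.

Lemma vertex_derivative_coord (mu : set T -> \bar R) a w j : has_coord mu a ->
  vertex_derivative q SG mu (kusuoka nu) w j =
  (coord_sum (a *m Mword R w) + 3 * (a *m Mword R w) 0 j) / (S w + 3 * s w j).
Proof.
move=> aE; rewrite /vertex_derivative; apply/cvg_lim => //.
have [_ /(_ j) den_gt0] := col_sum_gt0 w.
have den_neq0 : S w + 3 * s w j != 0 by rewrite gt_eqF.
have := cvg_coord_sum_ratio (s := a *m Mword R w) den_neq0.
apply: cvg_trans; apply: near_eq_cvg; near=> m.
by rewrite aE [X in _ / fine X](has_coord_kusuoka (w ++ nseq m j)) Mword_cat !mulmxA.
Unshelve. all: by end_near. Qed.

Definition vertex_weights w : 'rV[R]_3 := \row_j ((S w + 3 * s w j) / (6 * S w)).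

Lemma cell_weights_vertex_weights w :
  cell_weights q SG (kusuoka nu) w (vertex_weights w).
Proof.
have [S_gt0 den_gt0] := col_sum_gt0 w.
have S_neq0 : S w != 0 by rewrite gt_eqF.
have d0 : S w + 3 * s w i0 != 0 by rewrite gt_eqF.
have d1 : S w + 3 * s w i1 != 0 by rewrite gt_eqF.
have d2 : S w + 3 * s w i2 != 0 by rewrite gt_eqF.
split.
  under eq_bigr do rewrite mxE.
  rewrite -mulr_suml big_split /= -mulr_sumr sumr_const card_ord.
  by rewrite -[\sum_j _]/(S w); field.
move=> mu hmu; have [a aE] := has_coord_space hmu.
rewrite (cell_average_coord w hmu aE).
under eq_bigr => j _ do rewrite (vertex_derivative_coord w j aE) mxE.
set t := a *m _; have tE : coord_sum t = t 0 i0 + t 0 i1 + t 0 i2 by exact: sum3E.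
by rewrite sum3E tE; field; rewrite S_neq0 d0 d1 d2.
Qed.

Lemma nu_space i : in_energy_measure_space q SG (charge_of_finite_measure (nu i)).
Proof.
exists 1%N, (fun=> 1), (fun=> h i), (fun=> h i), (fun=> charge_of_finite_measure (nu i)).
split=> [_|A mA]; last by rewrite big_ord1 mul1e.
by split; [case: (hh i)|case: (hh i)|exact: hnu].
Qed.

(** Testing on each [nu i] gives one linear equation per row of [Mword R w]; its
    invertibility leaves a system with matrix [J + 3], [J] being the all-ones
    matrix, whose only eigenvalues are 3 and 6. *)
Lemma cell_weights_unique w b b' :
  cell_weights q SG (kusuoka nu) w b -> cell_weights q SG (kusuoka nu) w b' -> b = b'.
Proof.
move=> [_ hb] [_ hb']; have [_ den_gt0] := col_sum_gt0 w.
(* The difference of the weights is rescaled by the denominators of the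
   derivatives, which leaves [Mword R w *m (J + 3)] as matrix of the system. *)
pose d j := S w + 3 * s w j; pose c j := (b 0 j - b' 0 j) / d j.
pose v : 'cV[R]_3 := \col_j (\sum_k c k + 3 * c j).
have Mv0 : Mword R w *m v = 0.
  apply/colP => i; rewrite [RHS]mxE.
  have rowE : delta_mx 0 i *m Mword R w = row i (Mword R w) by rewrite -rowE.
  pose vd j := vertex_derivative q SG (charge_of_finite_measure (nu i)) (kusuoka nu) w j.
  have vdE j : vd j =
     (coord_sum (row i (Mword R w)) + 3 * Mword R w i j) / d j.
    by rewrite /vd (vertex_derivative_coord w j (has_coord_nu i)) rowE [row _ _ _ _]mxE.
  transitivity (\sum_j b 0 j * vd j - \sum_j b' 0 j * vd j); last first.
    by rewrite -hb -?hb' ?subrr //; exact: nu_space.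
  rewrite !mxE !sum3E !vdE /coord_sum !sum3E !mxE /c !sum3E.
  by ring.
have v0 : v = 0 by rewrite -(mulKmx (Mword_unit R w) v) Mv0 mulmx0.
have vE j : \sum_k c k + 3 * c j = 0 by have /colP/(_ j) := v0; rewrite !mxE.
have c0 j : c j = 0.
  have := (vE i0, vE i1, vE i2); rewrite !sum3E => -[[e0 e1] e2].
  by elim/ord3_ind: j; lra.
apply/rowP => j; apply/eqP; rewrite -subr_eq0; have /eqP := c0 j.
rewrite mulf_eq0 invr_eq0 => /orP[//|/eqP dj0].
by have := den_gt0 j; rewrite -/(d j) dj0 ltxx.
Qed.

End Charges.

Theorem theorem6p1 (R : realType) (q : 'I_3 -> 'rV[R]_2)
    (hq : equilateral q)
    (SG : set 'rV[R]_2) (hSG : is_sierpinski q SG)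
    (h : 'I_3 -> 'rV[R]_2 -> R) (hh : harmonic_basis q SG h)
    (nu : 'I_3 -> {finite_measure set (borel_plane R) -> \bar R})
    (hnu : forall i, is_energy_measure q SG (h i) (h i) (nu i))
    (w : seq 'I_3) :
  (exists! b : 'rV[R]_3, cell_weights q SG (kusuoka nu) w b) /\
  (forall b : 'rV[R]_3, cell_weights q SG (kusuoka nu) w b ->
     forall j : 'I_3,
       b ord0 j = 1 / 6 + 1 / 2 * ((\sum_i Mword R w i j) /
                                   (\sum_i \sum_k Mword R w i k))).
Proof.
have hw := cell_weights_vertex_weights hq hSG hh hnu w.
have uniq_w := cell_weights_unique hh hnu.
split; first by exists (vertex_weights R w); split => // b; exact: uniq_w.
move=> b hb j; rewrite (uniq_w _ _ _ hb hw) mxE.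
have [S_gt0 _] := col_sum_gt0 R w.
have sE k : (const_mx 1 *m Mword R w) 0 k = \sum_i Mword R w i k.
  by rewrite mxE; apply: eq_bigr => i _; rewrite mxE mul1r.
have SE : coord_sum (const_mx 1 *m Mword R w) = \sum_i \sum_k Mword R w i k.
  by rewrite exchange_big; apply: eq_bigr => k _; exact: sE.
by rewrite sE -SE; field; rewrite gt_eqF.
Qed.
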